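(* If $\mathcal{A}$ is an essential finite automaton with bounded ambiguity and $\breve{\mathcal{A}}$ is its base automaton, then $h(\mathcal{A})=h(\breve{\mathcal{A}})$.
   Context: A finite automaton $\mathcal{A}=(Q,\Sigma,\delta,\mathcal{I},\mathcal{F})$ has a finite set of states $Q$, finite alphabet $\Sigma$, transition function $\delta:Q\times\Sigma\to 2^Q$, initial states $\mathcal{I}\subseteq Q$ and final states $\mathcal{F}\subseteq Q$. Its Moore diagram is the directed labelled (multi)graph on $Q$ with an edge labelled $x$ from $q$ to $q'$ whenever $q'\in\delta(q,x)$. An admissible path is a directed path (possibly of length $0$) from an initial state to a final state; $L(\mathcal{A})$ is the set of labels of admissible paths. $\mathcal{A}$ is essential if every vertex of its Moore diagram lies on some admissible path. $\mathcal{A}$ has bounded ambiguity if there is $k\geq1$ such that each $w\in L(\mathcal{A})$ is the label of at most $k$ admissible paths. The entropy of a language $L$ is $h(L)=\limsup_{n\to\infty}\frac{\log|B_n(L)|}{n}$, where $B_n(L)$ is the set of words of length $n$ in $L$ (with $\log 0=-\infty$), and $h(\mathcal{A})=h(L(\mathcal{A}))$. Let $(V,E)$ be the underlying directed graph (multigraph) of the Moore diagram of $\mathcal{A}$. The base automaton $\breve{\mathcal{A}}$ is the automaton with the same underlying graph $(V,E)$, in which all states are both initial and final, and all edges have pairwise different labels: each $e\in E$ is labelled by its own letter $x_e$. *)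

(* Defs.v *)
From HB Require Import structures.
From mathcomp Require Import all_boot all_order all_algebra.
From mathcomp Require Import all_classical all_reals all_analysis.

Set Implicit Arguments.
Unset Strict Implicit.
Unset Printing Implicit Defensive.

Import Order.TTheory GRing.Theory Num.Theory.
Import numFieldNormedType.Exports.

Local Open Scope classical_set_scope.
Local Open Scope card_scope.
Local Open Scope ring_scope.

Record automaton := Automaton {
  state : finType;
  letter : finType;
  delta : state -> letter -> {set state};
  initial : {set state};
  final : {set state} }.

(* The labels are part of the edges, so that parallel edges of the Moore
   diagram are distinct. *)
Definition edge (A : automaton) : finType :=
  {e : state A * letter A * state A | e.2 \in delta e.1.1 e.1.2}.

Definition edge_src (A : automaton) (e : edge A) : state A := (val e).1.1.
Definition edge_label (A : automaton) (e : edge A) : letter A := (val e).1.2.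
Definition edge_tgt (A : automaton) (e : edge A) : state A := (val e).2.

Fixpoint chained (A : automaton) (q : state A) (s : seq (edge A)) : bool :=
  if s is e :: s' then (edge_src e == q) && chained (edge_tgt e) s' else true.

(* A path is given by its first vertex and its sequence of edges; the first
   vertex is needed to tell apart the paths of length 0. *)
Definition diagram_path (A : automaton) : Type := (state A * seq (edge A))%type.

Definition path_vertices (A : automaton) (p : diagram_path A) : seq (state A) :=
  p.1 :: map (@edge_tgt A) p.2.

Definition path_end (A : automaton) (p : diagram_path A) : state A :=
  last p.1 (map (@edge_tgt A) p.2).

Definition path_label (A : automaton) (p : diagram_path A) : seq (letter A) :=
  map (@edge_label A) p.2.

Definition admissible (A : automaton) (p : diagram_path A) : bool :=
  [&& chained p.1 p.2, p.1 \in initial A & path_end p \in final A].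

Definition language (A : automaton) : set (seq (letter A)) :=
  [set w | exists p : diagram_path A, admissible p /\ path_label p = w].
Arguments language : clear implicits.

Definition essential (A : automaton) : Prop :=
  forall q : state A,
    exists p : diagram_path A, admissible p /\ q \in path_vertices p.

Definition bounded_ambiguity (A : automaton) : Prop :=
  exists k : nat, (1 <= k)%N /\
    forall w : seq (letter A), language A w ->
      [set p : diagram_path A | admissible p /\ path_label p = w] #<= `I_k.

Definition words_of_length (X : finType) (L : set (seq X)) (n : nat)
  : {set n.-tuple X} := [set w : n.-tuple X | `[< L (tval w) >]]%SET.

(* lne 0 = -oo; the (junk) term of index 0 does not affect the limsup. *)
Definition language_entropy (R : realType) (X : finType) (L : set (seq X))
  : \bar R :=
  limn_esup (fun n : nat =>
    (lne (#|words_of_length L n|%:R%:E) / (n%:R%:E))%E : \bar R).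

Definition entropy (R : realType) (A : automaton) : \bar R :=
  language_entropy R (language A).

Definition base_automaton (A : automaton) : automaton :=
  {| state := state A;
     letter := edge A;
     delta := fun q e => if edge_src e == q then [set edge_tgt e]%SET else finset.set0;
     initial := [set: state A]%SET;
     final := [set: state A]%SET |}.

(* Main.v *)
Require Import Defs.
From mathcomp Require Import all_boot all_order all_algebra.
From mathcomp Require Import all_classical all_reals all_analysis.

Set Implicit Arguments.
Unset Strict Implicit.
Unset Printing Implicit Defensive.

Import Order.TTheory GRing.Theory Num.Theory.
Import numFieldNormedType.Exports.

Local Open Scope classical_set_scope.
Local Open Scope card_scope.
Local Open Scope ring_scope.

(** Write [a n] and [b n] for the numbers of words of length [n] in the
    languages of the automaton and of its base automaton; for [n > 0], [b n]
    counts paths of length [n].  Distinct labels come from distinct paths, so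
    [a n <= b n].  Conversely, fix for every state a path to it from an initial
    state and a path from it to a final state.  These extend every path from
    [q] to [q'] to an admissible path which is longer by an amount depending
    only on [(q, q')], and at most [k] of the extended paths share a label.
    Hence [b n] is at most a constant times a sum of boundedly many
    [a (n + m)], and this does not change the exponential growth rate. *)

(** Exponentiating removes the logarithm. Since [lne] sends 0 to -oo and [expR] is positive, [x = 0]
    is included, so lengths without words need no separate case. *)
Lemma lne_div_le (R : realType) (x c : R) (n : nat) :
  0 <= x -> (0 < n)%N ->
  (lne x%:E / n%:R%:E <= c%:E)%E = (x <= expR (c * n%:R)).
Proof.
move=> x0 n0; have n0' : 0 < n%:R :> R by rewrite ltr0n.
rewrite inver gt_eqF// lee_pdivrMr// -lee_expeR lneK//.
by rewrite in_itv/= lee_fin x0 leey.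
Qed.

Lemma limn_esup_lt_near (R : realType) (u : (\bar R)^nat) (c : \bar R) :
  (limn_esup u < c)%E -> \forall n \near \oo, (u n <= c)%E.
Proof.
move=> /ereal_inf_lt[_ [V FV <-] /ltW supVc].
apply: filterS FV => n Vn; apply: le_trans supVc.
by apply: ereal_sup_ubound; exists n.
Qed.

Lemma near_limn_esup_le (R : realType) (u : (\bar R)^nat) (c : \bar R) :
  (\forall n \near \oo, (u n <= c)%E) -> (limn_esup u <= c)%E.
Proof.
move=> uc; apply: ge_ereal_inf.
exists (ereal_sup (u @` [set n | (u n <= c)%E])).
  by exists [set n | (u n <= c)%E].
by apply: ge_ereal_sup => _ [n /= un <-].
Qed.

(** Testing against real [c] only keeps all later constants [expR (c * m)] real, even when an
    entropy is infinite. *)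
Lemma lee_real_gtW (R : realType) (x y : \bar R) :
  (forall c : R, (y < c%:E)%E -> (x <= c%:E)%E) -> (x <= y)%E.
Proof.
case: y => [r| |] h; last 2 first.
- exact: leey.
- case: x h => [r| |] h //; last by have := h 0 (ltNyr _).
  by have := h (r - 1) (ltNyr _); rewrite lee_fin leNgt gtrBl ltr01.
by apply/lee_addgt0Pr => e e0; rewrite -EFinD; apply: h; rewrite lte_fin ltrDl.
Qed.

(** If [L] eventually has at most e^(cn) words of length n, the factors e^(cm) coming from the
    shifts collect into a constant [D], and e^(en) absorbs [D] for every e > 0. The shifts only
    increase the length, so the eventual bound applies to each term. *)
Lemma language_entropy_le (R : realType) (X Y : finType)
    (L : set (seq X)) (M : set (seq Y)) (K C : nat) :
  (forall n, #|words_of_length M n| <=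
             K * \sum_(m < C) #|words_of_length L (n + m)|)%N ->
  (language_entropy R M <= language_entropy R L)%E.
Proof.
move=> MKL; apply: lee_real_gtW => c /limn_esup_lt_near Lc.
pose D : R := K%:R * \sum_(m < C) expR (c * m%:R).
have D0 : 0 <= D by rewrite mulr_ge0// sumr_ge0// => m _; exact: expR_ge0.
apply/lee_addgt0Pr => e e0; rewrite -EFinD; apply: near_limn_esup_le.
have [N _ LN] := Lc.
near=> n.
have n0 : (0 < n)%N by near: n; exists 1%N.
have Nn : (N <= n)%N by near: n; exists N.
rewrite lne_div_le// mulrDl expRD.
apply: (@le_trans _ _ (expR (c * n%:R) * D)).
  apply: (@le_trans _ _ (K * \sum_(m < C) #|words_of_length L (n + m)|)%:R).
    by rewrite ler_nat.
  rewrite natrM /D mulrCA ler_wpM2l// natr_sum mulr_sumr ler_sum// => m _.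
  rewrite -expRD -mulrDr -natrD -lne_div_le ?addn_gt0 ?n0//.
  by apply: LN; rewrite /= (leq_trans Nn)// leq_addr.
rewrite ler_wpM2l ?expR_ge0//.
(* [e^x >= x] beats the constant [D] once [n >= D / e]. *)
apply: (@le_trans _ _ (1 + e * n%:R)); last exact: expR_ge1Dx.
rewrite (@le_trans _ _ (e * n%:R))// ?lerDr//.
rewrite mulrC -ler_pdivrMr//.
by near: n; exact: nbhs_infty_ger.
Unshelve. all: by end_near. Qed.

Lemma chained_cat (A : automaton) (q : state A) (s t : seq (edge A)) :
  chained q (s ++ t) = chained q s && chained (path_end (q, s)) t.
Proof.
by rewrite /path_end /=; elim: s q => //= e s IHs q; rewrite IHs andbA.
Qed.

Lemma path_end_cat (A : automaton) (q : state A) (s t : seq (edge A)) :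
  path_end (q, s ++ t) = path_end (path_end (q, s), t).
Proof. by rewrite /path_end /= map_cat last_cat. Qed.

Lemma path_vertices_split (A : automaton) (q v : state A) (s : seq (edge A)) :
  v \in path_vertices (q, s) ->
  exists s1 s2 : seq (edge A), s = s1 ++ s2 /\ path_end (q, s1) = v.
Proof.
rewrite /path_vertices /path_end /=; elim: s q => [|e s IHs] q /=.
  by rewrite inE => /eqP ->; exists [::], [::].
rewrite inE => /predU1P[->|/IHs[s1 [s2 [-> <-]]]].
  by exists [::], (e :: s).
by exists (e :: s1), s2.
Qed.

(** An admissible path through [q] is cut at [q]: its first half gives [u q], its second half [v q].
    Making these choices once per state lets the added length depend only on the two ends of [s]. *)
Lemma essential_extensions (A : automaton) : essential A ->
  exists (i : state A -> state A) (u v : state A -> seq (edge A)),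
    forall (q : state A) (s : seq (edge A)), chained q s ->
      admissible (i q, u q ++ s ++ v (path_end (q, s))).
Proof.
move=> ess.
have split_at q : exists t : state A * seq (edge A) * seq (edge A),
    [/\ t.1.1 \in initial A, chained t.1.1 t.1.2, path_end t.1 = q,
        chained q t.2 & path_end (q, t.2) \in final A].
  have [[q0 s] [/and3P[/= sP q0I]]] := ess q.
  move=> + /path_vertices_split[s1 [s2 [sE s1q]]].
  move: sP; rewrite sE chained_cat path_end_cat s1q => /andP[s1P s2P] s2F.
  by exists (q0, s1, s2).
have [f fP] := choice split_at.
exists (fun q => (f q).1.1), (fun q => (f q).1.2), (fun q => (f q).2) => q s sP.
have [iI uP uq _ _] := fP q; have [_ _ _ vP vF] := fP (path_end (q, s)).
rewrite /admissible /= !chained_cat !path_end_cat -!surjective_pairing uP uq sP.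
by rewrite iI vP vF.
Qed.

(** An edge of the base automaton is a triple whose middle entry is an edge of [A]; the transition
    set is empty unless the outer entries are the ends of that edge. *)
Lemma base_edge_ends (A : automaton) (e : edge (base_automaton A)) :
  edge_src e = edge_src (edge_label e) /\ edge_tgt e = edge_tgt (edge_label e).
Proof.
case: e => -[[p e] p']; rewrite /edge_label /edge_tgt {1}/edge_src /=.
move=> pep'; move: (pep'); case: eqP => [ep|_]; rewrite inE // => /eqP ->.
by rewrite ep.
Qed.

(** All states are initial and final, so admissibility reduces to chaining. The state [q] is a real
    choice only for the empty word. *)
Lemma language_base (A : automaton) (s : seq (edge A)) :
  language (base_automaton A) s <-> exists q : state A, chained q s.
Proof.
split=> [[[q t] [/and3P[/= tP _ _] <-]]|[q sP]].
  exists q; rewrite /path_label /=; elim: t q tP => //= e t IHt q.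
  have [-> ->] := base_edge_ends e.
  by move=> /andP[-> /IHt ->].
have eP (e : edge A) :
    edge_tgt e \in @delta (base_automaton A) (edge_src e) e.
  by rewrite /= eqxx inE.
pose lift (e : edge A) : edge (base_automaton A) :=
  Sub (edge_src e, e, edge_tgt e) (eP e).
exists (q, map lift s); split; last by rewrite /path_label /= -map_comp map_id.
rewrite /admissible !inE !andbT /=.
by elim: s q sP => //= e s IHs q /andP[-> /IHs ->].
Qed.

Lemma words_of_length_le_base (A : automaton) (n : nat) :
  (#|words_of_length (language A) n| <=
   #|words_of_length (language (base_automaton A)) n|)%N.
Proof.
apply: leq_trans (leq_imset_card (fun s : n.-tuple (edge A) =>
  [tuple of map (@edge_label A) s]) _).
apply/subset_leq_card/fintype.subsetP => w.
rewrite inE => /asboolP[[q s] [/and3P[/= sP _ _] sw]].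
have sn : size s == n by rewrite -(size_tuple w) -sw size_map.
apply/imsetP; exists (Tuple sn); last exact/val_inj.
by rewrite inE; apply/asboolP/language_base; exists q.
Qed.

Lemma card_cover_le (X J : finType) (D : {set J}) (B : {set X})
    (W : J -> {set X}) (N : nat) :
  (forall x, x \in B -> exists2 j, j \in D & x \in W j) ->
  (forall j, j \in D -> #|W j| <= N)%N -> (#|B| <= #|D| * N)%N.
Proof.
move=> BW WN; apply: (@leq_trans #|\bigcup_(j in D) W j|%SET).
  apply/subset_leq_card/fintype.subsetP => x /BW[j jD xj].
  by apply/finset.bigcupP; exists j.
rewrite -sum_nat_const.
elim/big_rec2: _ => [|j m U jD Um]; first by rewrite cards0.
by rewrite (leq_trans (leq_card_setU _ _))// leq_add// WN.
Qed.

Lemma card_le_ord_inj (T : Type) (X : finType) (P : set T) (B : {set X})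
    (f : X -> T) (k : nat) :
  P #<= `I_k -> {in B &, injective f} -> (forall x, x \in B -> P (f x)) ->
  (#|B| <= k)%N.
Proof.
move=> /pcard_leP/injfunPex[g gP ginj] finj fP.
rewrite cardE -(size_map (g \o f)) -[leqRHS](size_iota 0).
apply: uniq_leq_size => [|_ /mapP[x + ->]]; last first.
  by rewrite mem_enum mem_iota => /fP/gP.
rewrite map_inj_in_uniq ?enum_uniq// => x y; rewrite !mem_enum => xB yB gxy.
by apply: finj => //; apply: ginj => //; rewrite inE; exact: fP.
Qed.

Lemma base_words_of_length_le (A : automaton) (k : nat) :
  essential A ->
  (forall w, language A w ->
    [set p : diagram_path A | admissible p /\ path_label p = w] #<= `I_k) ->
  exists K C : nat, forall n,
    (#|words_of_length (language (base_automaton A)) n| <=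
      K * \sum_(m < C) #|words_of_length (language A) (n + m)|)%N.
Proof.
move=> /essential_extensions[i [u [v ext]]] amb.
(* One factor counts the pairs of ends of a path, the other bounds the paths sharing a label. *)
exists (#|[set: state A * state A]%SET| * k)%N.
(* Summing over all states bounds every added length [size (u q) + size (v q')] at once. *)
exists (\sum_q size (u q) + \sum_q size (v q)).+1 => n.
rewrite -mulnA; apply: (@card_cover_le _ _ _ _ (fun t =>
  [set s : n.-tuple (edge A) |
    chained t.1 s & path_end (t.1, val s) == t.2]%SET)).
  move=> s; rewrite inE => /asboolP/language_base[q sP].
  by exists (q, path_end (q, val s)); rewrite !inE//= sP eqxx.
move=> [q q'] _ /=; set W := (W in #|pred_of_set W|).
pose m := (size (u q) + size (v q'))%N.
have mC : (m < (\sum_q size (u q) + \sum_q size (v q)).+1)%N.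
  rewrite ltnS; apply: leq_add; first by rewrite (bigD1 q)//= leq_addr.
  by rewrite (bigD1 q')//= leq_addr.
apply: (@leq_trans (#|words_of_length (language A) (n + m)| * k)%N); last first.
  by rewrite mulnC leq_mul2l (bigD1 (Ordinal mC))//= leq_addr orbT.
pose extend (s : seq (edge A)) : diagram_path A := (i q, u q ++ s ++ v q').
have extendP s : s \in W -> admissible (extend s).
  by rewrite inE => /andP[sP /eqP sq']; rewrite /extend -sq' ext.
rewrite -/W.
(* With both ends fixed, the paths are sorted by the label of their extension, which has length
   [n + m]. *)
apply: (@card_cover_le _ _ _ _ (fun w : (n + m).-tuple (letter A) =>
    [set s : n.-tuple (edge A) in W | path_label (extend s) == w]%SET))
  => [s sW|w].
  have sz : size (path_label (extend s)) == (n + m)%N.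
    by rewrite size_map !size_cat size_tuple addnCA.
  exists (Tuple sz); rewrite inE ?sW//=.
  by apply/asboolP; exists (extend s); split => //; exact: extendP.
rewrite inE => /asboolP/amb/(@card_le_ord_inj _ _ _ _ (extend \o val)); apply.
(* Extension is injective here: the same prefix and suffix are added to sequences of equal
   length. *)
- move=> s t _ _ [/eqP]; rewrite eqseq_cat// eqxx /= eqseq_cat ?size_tuple//.
  by move=> /andP[/eqP ? _]; exact: val_inj.
- by move=> s; rewrite inE => /andP[/extendP sP /eqP].
Qed.

Theorem proposition5p21 (R : realType) (A : automaton)
  (hess : essential A) (hamb : bounded_ambiguity A) :
  entropy R A = entropy R (base_automaton A).
Proof.
have [k [_ amb]] := hamb.
have [K [C KC]] := base_words_of_length_le hess amb.
apply/eqP; rewrite eq_le; apply/andP; split; last exact: language_entropy_le KC.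
(* With both constants 1, only the shift 0 remains and the bound is termwise. *)
apply: (@language_entropy_le _ _ _ _ _ 1 1) => n.
by rewrite mul1n big_ord1 addn0 words_of_length_le_base.
Qed.
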